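(* For every countable ordinal $\alpha$ there exists a topologically transitive, completely scrambled, countable WAP system of height greater than $\alpha$.
   Context: A system $(X,T)$ here is a homeomorphism $T$ of a nonempty compact metric space $(X,d)$; it is countable if $X$ is countable. It is topologically transitive if for all nonempty open $U,V\subset X$ there is $n\in\mathbb Z$ with $T^{-n}U\cap V\ne\emptyset$. It is WAP if every element of the closure of $\{T^n:n\in\mathbb Z\}$ in $X^X$ (pointwise convergence) is continuous. A pair $(x,y)$ is proximal if $\liminf_{n\to+\infty}d(T^nx,T^ny)=0$ and asymptotic if $\lim_{n\to+\infty}d(T^nx,T^ny)=0$. The system is completely scrambled if every pair in $X\times X$ is proximal and no pair $(x,y)$ with $x\ne y$ is asymptotic. For $x\in X$ let $R_T(x)$ be the set of limit points of $\{T^nx\}$ as $n\to+\infty$ or $n\to-\infty$; for a closed invariant $Y\subset X$ let $z_{LIM}(Y)=\overline{\bigcup_{x\in Y}R_T(x)}$. Define $z_0=X$, $z_{\alpha+1}=z_{LIM}(z_\alpha)$, and $z_\beta=\bigcap_{\alpha<\beta}z_\alpha$ for limit ordinals $\beta$. The height of $(X,T)$ is the first ordinal $\beta$ with $z_\beta=z_{\beta+1}$. *)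

(* Defs.v *)
From mathcomp Require Import all_boot all_order all_algebra.
From mathcomp Require Import all_classical all_reals all_analysis.
From mathcomp Require Import wochoice.

Set Implicit Arguments.
Unset Strict Implicit.
Unset Printing Implicit Defensive.

Import Order.TTheory GRing.Theory Num.Theory.
Import numFieldNormedType.Exports.

Local Open Scope classical_set_scope.
Local Open Scope ring_scope.

(** * Ordinals *)

(* A well-ordered type; it stands for the ordinal that is its order type. *)
Record wotype := WOType {
  wo_sort :> Type;
  wo_le : rel wo_sort;
  wo_leP : well_order wo_le }.

Arguments wo_le {w}.

Definition wo_lt (W : wotype) (x y : W) : Prop := ~~ wo_le y x.

(* V < W as ordinals: V is isomorphic to the proper initial segment of W
   below some w. *)
Definition ord_lt (V W : wotype) : Prop :=
  exists (w : W) (f : V -> W),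
    (forall x y, wo_le (f x) (f y) = wo_le x y) /\
    range f = [set u | wo_lt u w].

Definition is_succ_of (W : wotype) (v w : W) : Prop :=
  wo_lt v w /\ forall u, wo_lt v u -> wo_le w u.

Section wotype_theory.
Variable W : wotype.
Implicit Types x y u v w : W.

Lemma wo_refl x : wo_le x x.
Proof.
have [|z [[/asboolP -> lb] _]] := wo_leP (w := W) (A := [pred y | `[<y = x>]]).
  by exists x; apply/asboolP.
by apply: lb; apply/asboolP.
Qed.

Lemma wo_total x y : wo_le x y || wo_le y x.
Proof.
have [|z [[/asboolP hz lb] _]] :=
    wo_leP (w := W) (A := [pred u | `[<u = x \/ u = y>]]).
  by exists x; apply/asboolP; left.
have zx : wo_le z x by apply: lb; apply/asboolP; left.
have zy : wo_le z y by apply: lb; apply/asboolP; right.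
by case: hz => hz; rewrite hz in zx zy; rewrite ?zx ?zy ?orbT.
Qed.

Lemma wo_anti x y : wo_le x y -> wo_le y x -> x = y.
Proof.
move=> xy yx.
have [|z [_ uz]] := wo_leP (w := W) (A := [pred u | `[<u = x \/ u = y>]]).
  by exists x; apply/asboolP; left.
rewrite -(uz x) ?(uz y) //; split; try by apply/asboolP; auto.
  by move=> u /asboolP[]->//; exact: wo_refl.
by move=> u /asboolP[]->//; exact: wo_refl.
Qed.

Lemma wo_trans x y z : wo_le x y -> wo_le y z -> wo_le x z.
Proof.
move=> xy yz.
have [|t [[/asboolP ht lb] _]] :=
    wo_leP (w := W) (A := [pred u | `[<[\/ u = x, u = y | u = z]>]]).
  by exists x; apply/asboolP; constructor 1.
have tx : wo_le t x by apply: lb; apply/asboolP; constructor 1.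
have ty : wo_le t y by apply: lb; apply/asboolP; constructor 2.
have tz : wo_le t z by apply: lb; apply/asboolP; constructor 3.
case: ht => ht; rewrite ht in tx ty tz => //.
  by rewrite (wo_anti xy tx).
by rewrite -(wo_anti yz ty).
Qed.

Lemma wo_ltW x y : wo_lt x y -> wo_le x y.
Proof. by move=> /negbTE xy; have := wo_total x y; rewrite xy orbF. Qed.

Lemma wo_lt_wf : well_founded (@wo_lt W).
Proof.
move=> x; apply: contrapT => nax.
have [|z [[/asboolP hz lb] _]] :=
    wo_leP (w := W) (A := [pred u | `[<~ Acc (@wo_lt W) u>]]).
  by exists x; apply/asboolP.
apply: hz; constructor => y yz; apply: contrapT => nay.
by move: yz; rewrite /wo_lt lb //; apply/asboolP.
Qed.

Lemma is_succ_of_inj v v' w : is_succ_of v w -> is_succ_of v' w -> v = v'.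
Proof.
move=> [vw h] [v'w h']; apply: wo_anti; apply: contrapT => /negP uv.
  by have := h' _ uv; apply/negP.
by have := h _ uv; apply/negP.
Qed.

End wotype_theory.

Section successor.
Variable W : wotype.

Definition succ_le : rel (option W) := fun x y =>
  match x, y with
  | _, None => true
  | None, Some _ => false
  | Some v, Some w => wo_le v w
  end.

Lemma succ_leP : well_order succ_le.
Proof.
apply: antisymmetric_well_order => [[x|] [y|]//= /andP[xy yx]|A [a Aa]].
  by rewrite (wo_anti xy yx).
have [[w Aw]|nA] := pselect (nonempty [pred v : W | Some v \in A]); last first.
  exists a; split=> // -[v|] Av; last by case: a Aa.
  by case: nA; exists v.
have [|z [[Az lb] _]] := wo_leP (w := W) (A := [pred v : W | Some v \in A]).
  by exists w.
by exists (Some z); split=> // -[v|//] Av; exact: lb.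
Qed.

(* W + 1, with None as the new greatest element *)
Definition wo_succ : wotype := WOType succ_leP.

End successor.

(** * Systems *)

Record system (R : realType) := System {
  space :> metricType R;
  space_nonempty : [set: space] !=set0;
  space_compact : compact [set: space];
  smap : space -> space;
  smap_inv : space -> space;
  smapK : cancel smap smap_inv;
  smap_invK : cancel smap_inv smap;
  smap_continuous : continuous smap;
  smap_inv_continuous : continuous smap_inv }.

Section dynamics.
Variables (R : realType) (S : system R).
Implicit Types (x y : S) (Y : set S).

Definition smap_pow (n : int) : S -> S :=
  match n with
  | Posz k => iter k (@smap R S)
  | Negz k => iter k.+1 (@smap_inv R S)
  end.

Definition countable_system : Prop := countable [set: S].

Definition topologically_transitive : Prop :=
  forall U V : set S, open U -> open V -> U !=set0 -> V !=set0 ->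
    exists n : int, (smap_pow n @^-1` U) `&` V !=set0.

Definition WAP : Prop :=
  forall f : {ptws S -> S},
    closure (range (smap_pow : int -> {ptws S -> S})) f ->
    continuous (f : S -> S).

Definition orbit_dist x y : nat -> R :=
  fun n => mdist (smap_pow n%:Z x) (smap_pow n%:Z y).

Definition proximal x y : Prop :=
  limn_einf (fun n => (orbit_dist x y n)%:E) = 0%E.

Definition asymptotic x y : Prop := orbit_dist x y @ \oo --> (0 : R).

Definition completely_scrambled : Prop :=
  (forall x y, proximal x y) /\ (forall x y, x <> y -> ~ asymptotic x y).

Definition RT x : set S :=
  cluster ((fun n : nat => smap_pow n%:Z x) @ \oo) `|`
  cluster ((fun n : nat => smap_pow (- n%:Z) x) @ \oo).

Definition zLIM Y : set S := closure (\bigcup_(x in Y) RT x).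

(* The transfinite sequence z along a well-ordered type W: the term at w : W is
   the one indexed by the order type of {v | v < w}. The intersection over an
   empty set of predecessors gives the initial value [set: S]. *)
Definition zstep (W : wotype) (w : W) (rec : forall v, wo_lt v w -> set S) :
    set S :=
  match pselect (exists v, is_succ_of v w) with
  | left h => zLIM (rec (projT1 (cid h)) (proj1 (projT2 (cid h))))
  | right _ => [set x | forall v (vw : wo_lt v w), rec v vw x]
  end.

Definition zpos (W : wotype) : W -> set S :=
  Fix (@wo_lt_wf W) (fun=> set S) (@zstep W).

(* the term indexed by the ordinal W itself *)
Definition z_ (W : wotype) : set S := zpos (None : wo_succ W).

Definition is_height (W : wotype) : Prop :=
  z_ W = z_ (wo_succ W) /\
  forall V : wotype, ord_lt V W -> z_ V <> z_ (wo_succ V).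

Definition height_gt (A : wotype) : Prop :=
  exists W : wotype, is_height W /\ ord_lt A W.

Lemma zposE (W : wotype) (w : W) : zpos w = zstep (fun v (_ : wo_lt v w) => zpos v).
Proof.
rewrite /zpos Fix_eq // => {}w f g fg; congr zstep.
by apply/functional_extensionality_dep => v; apply/funext => vw; exact: fg.
Qed.

Lemma zpos_zero (W : wotype) (w : W) :
  (forall v, ~ wo_lt v w) -> zpos w = [set: S].
Proof.
move=> w0; rewrite zposE /zstep; case: pselect => [[v [/w0]]//|_].
by apply/seteqP; split=> // x _ v vw; have := w0 v vw.
Qed.

Lemma zpos_succ (W : wotype) (v w : W) :
  is_succ_of v w -> zpos w = zLIM (zpos v).
Proof.
move=> vw; rewrite zposE /zstep; case: pselect => [h|[]]; last by exists v.
by case: (cid h) => u uw /=; rewrite (is_succ_of_inj vw uw).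
Qed.

Lemma zpos_limit (W : wotype) (w : W) : (forall v, ~ is_succ_of v w) ->
  zpos w = \bigcap_(v in [set v | wo_lt v w]) zpos v.
Proof.
by move=> nw; rewrite zposE /zstep; case: pselect => [[v /nw]|] //.
Qed.

Lemma zpos_initial (V W : wotype) (f : V -> W) :
  (forall u v : V, wo_le (f u) (f v) = wo_le u v) ->
  (forall v u, wo_lt u (f v) -> exists v', f v' = u) ->
  forall v, zpos (f v) = zpos v.
Proof.
move=> fmono fdown; elim/(well_founded_ind (@wo_lt_wf V)) => v IH.
have flt (x y : V) : wo_lt (f x) (f y) = wo_lt x y by rewrite /wo_lt fmono.
have [[u uv]|nv] := pselect (exists u, is_succ_of u v).
  rewrite (zpos_succ uv) -IH; last by case: uv.
  apply: zpos_succ; split; first by rewrite flt; case: uv.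
  move=> t ut; apply: contrapT => /negP tv.
  have [t' tE] := fdown _ _ tv; subst t; move: tv; rewrite -/(wo_lt _ _) flt.
  by rewrite flt in ut; rewrite /wo_lt (proj2 uv).
rewrite (zpos_limit (w := v)); last by move=> u uv; apply: nv; exists u.
rewrite zpos_limit; last first.
  move=> t [tv ht]; have [t' tE] := fdown _ _ tv; subst t.
  apply: nv; exists t'; split; first by rewrite -flt.
  by move=> u tu; rewrite -fmono; apply: ht; rewrite flt.
apply/seteqP; split => x /= hx u uv.
  by rewrite -IH //; apply: hx => /=; rewrite flt.
have [u' uE] := fdown _ _ uv; subst u; rewrite /= flt in uv.
by rewrite IH //; exact: hx.
Qed.

Lemma z_succ (W : wotype) : z_ (wo_succ W) = zLIM (z_ W).
Proof.
rewrite {1}/z_ (@zpos_succ (wo_succ (wo_succ W)) (Some None)) => [|].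
  rewrite (@zpos_initial _ (wo_succ (wo_succ W)) (@Some (wo_succ W))) //.
  by move=> v [u|//] _; exists u.
by split=> // -[[u|]|].
Qed.

End dynamics.

Arguments z_ {R} S W.

(* Main.v *)
From HB Require Import structures.
Require Import Defs.
From mathcomp Require Import all_boot all_order all_algebra.
From mathcomp Require Import all_classical all_reals all_analysis.
From mathcomp Require Import wochoice zify ssrAC.

(** The systems come from commutative monoids with zero, written additively: the
    live elements [L] of a monoid [G], everything else in [G] being identified
    with zero.  Attach to each binary digit [r] a nonzero element [lab r] of
    [L], every such element being used infinitely often, and let [x n] be the
    sum of the elements attached to the digits 1 of [n], or zero if that sum is
    not live or if [n] is negative.  The orbit closure of the bi-infinite
    sequence [x] under the shift [T] consists of the zero sequence and of the
    sequences [g + x (t + a)], so it is the countable set of pairs [(a, g)]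
    together with the zero sequence, which is represented by [None].

    This set carries the product [(a, g) (b, h) = (a + b, g + h)], which is
    commutative and separately continuous ([label_mul_continuous]), and [T ^ n]
    is the product with [(n, 0)].  Any pointwise limit of powers of [T] is then
    again the product with a point, hence continuous: the system is WAP.
    Moreover [T ^ (2 ^ r)] converges to the product with [(0, u)] as [r] grows
    with [lab r = u] ([translate_exp_cvg]).  So the orbit of [x] is dense; an
    element [q] with [q + q] dead gives powers of [T] that tend to [None] at all
    points, which makes every pair proximal; and two distinct points stay
    distinct, by cancellation, after the product with some [(0, u)], which
    excludes asymptotic pairs.

    Compactness ([label_space_compact]) is where divisibility in [L] has to be
    well founded: a limit with infinitely many digits running off to the left
    would give an infinite chain of strict divisors.  Divisibility also governs
    the sets [z].  On one hand [zLIM Y] contains the products of points of [Y]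
    with [(0, u)] for [u <> 0] ([zLIM_label_mul]); on the other hand, if
    [(a, g)] is in [zLIM Y], some [(b, h)] in [Y] has [h] a strict divisor of
    [g] ([zLIM_divisor]), so that a set with [Y = zLIM Y] contains no point but
    [None].  As the sets decrease, the height exists and exceeds [alpha] as soon
    as the set of index [alpha] contains a point other than [None]
    ([height_gt_rest_point]).

    It remains to find [L] with divisibility of large rank.  Let [rho] map [nat]
    to [alpha + 1] and take every value infinitely often.  Live elements are the
    polynomials with nonnegative integer coefficients, and, in degree one of an
    extra grading, the polynomials whose negative coefficients are all equal to
    -1 and occur at indices along which [rho] strictly decreases; a sum of
    degree two is dead.  A strict divisor has a smaller sum of coefficients, and
    this sum is bounded below until a negative coefficient appears at a later
    index, where [rho] is smaller; whence well-foundedness ([divides_wf]).  And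
    [(1, f)] is the sum of [(0, 'X^i)] and [(1, f - 'X^i)] for large [i] with
    [rho i] prescribed, whence the rank ([descending_zpos]). *)

Set Implicit Arguments.
Unset Strict Implicit.
Unset Printing Implicit Defensive.

Import Order.TTheory GRing.Theory Num.Theory.
Import numFieldNormedType.Exports.

Local Open Scope classical_set_scope.
Local Open Scope ring_scope.

(** * Spaces coded by a sequence of clopen tests *)

Definition separates (T : Type) (b : nat -> T -> bool) :=
  forall x y, (forall i, b i x = b i y) -> x = y.

Section first_difference.
Variables (R : realType) (T : Type) (b : nat -> T -> bool).

Definition coded_dist (x y : T) : R :=
  if pselect (exists i, b i x != b i y) is left h then 2^-1 ^+ ex_minn h else 0.

Lemma coded_dist_ge0 x y : 0 <= coded_dist x y.
Proof.
by rewrite /coded_dist; case: pselect => // h; rewrite exprn_ge0// invr_ge0.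
Qed.

Lemma coded_dist_ge i x y : b i x != b i y -> 2^-1 ^+ i <= coded_dist x y.
Proof.
rewrite /coded_dist => bi; case: pselect => [h|[]]; last by exists i.
case: ex_minnP => m _ /(_ _ bi) mi.
by rewrite ler_wiXn2l// ?invr_ge0// invf_le1// ler1n.
Qed.

Lemma coded_dist_gt0P x y : 0 < coded_dist x y ->
  exists2 i, b i x != b i y & coded_dist x y = 2^-1 ^+ i.
Proof.
rewrite /coded_dist; case: pselect => [h _|]; last by rewrite ltxx.
by case: ex_minnP => m bm _; exists m.
Qed.

Lemma coded_dist_lt n x y : (forall i, (i <= n)%N -> b i x = b i y) ->
  coded_dist x y < 2^-1 ^+ n.
Proof.
move=> xy; rewrite /coded_dist; case: pselect => [h|_]; last first.
  by rewrite exprn_gt0// invr_gt0.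
case: ex_minnP => m bm _; rewrite ltr_iXn2l ?invr_gt0// ?invf_lt1// ?ltr1n//.
by rewrite ltnNge; apply: contra bm => mn; rewrite xy.
Qed.

Lemma coded_distxx x : coded_dist x x = 0.
Proof. by rewrite /coded_dist; case: pselect => // -[i hi]; case/eqP: (hi). Qed.

Lemma coded_dist_sym x y : coded_dist x y = coded_dist y x.
Proof.
wlog suff le_sym : x y / coded_dist x y <= coded_dist y x.
  by apply/eqP; rewrite eq_le !le_sym.
have [/coded_dist_gt0P[i bi ->]|] := ltP 0 (coded_dist x y).
  by rewrite coded_dist_ge// eq_sym.
by move=> /le_trans; apply; exact: coded_dist_ge0.
Qed.

Lemma coded_dist_triangle y x z :
  coded_dist x z <= coded_dist x y + coded_dist y z.
Proof.
have [/coded_dist_gt0P[i bi ->]|/le_trans] := ltP 0 (coded_dist x z);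
  last by apply; rewrite addr_ge0// coded_dist_ge0.
have [xy|xy] := eqVneq (b i x) (b i y).
  by rewrite -[leLHS]add0r lerD ?coded_dist_ge0// coded_dist_ge// -xy.
by rewrite -[leLHS]addr0 lerD ?coded_dist_ge0// coded_dist_ge.
Qed.

Lemma coded_dist_eq0 : separates b -> forall x y, coded_dist x y = 0 -> x = y.
Proof.
move=> sep x y xy0; apply: sep => i; apply/eqP; apply: contraT => bi.
have := coded_dist_ge bi.
by rewrite xy0 leNgt exprn_gt0// invr_gt0.
Qed.

End first_difference.

(** The tests separate points, so they define a metric by the rank of the first
    test on which two points differ. *)
Definition coded (R : realType) (T : choiceType) (b : nat -> T -> bool)
  of separates b : Type := T.

HB.instance Definition _ (R : realType) (T : choiceType) (b : nat -> T -> bool)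
    (sep : separates b) :=
  Choice.copy (@coded R T b sep) T.
HB.instance Definition _ (R : realType) (T : choiceType) (b : nat -> T -> bool)
    (sep : separates b) :=
  @isMetric.Build R (@coded R T b sep) (coded_dist R b) (coded_distxx R b)
    (coded_dist_eq0 sep) (coded_dist_sym R b) (coded_dist_triangle R b).

Section coded_topology.
Variables (R : realType) (T : choiceType) (b : nat -> T -> bool).
Variable sep : separates b.
Let X : metricType R := @coded R T b sep.

Lemma coded_near i (x : X) : \forall y \near x, b i y = b i x.
Proof.
apply/nbhs_ballP; exists (2^-1 ^+ i) => /=.
  by rewrite exprn_gt0// invr_gt0.
move=> y; rewrite ballEmdist/= => xy; apply/eqP; apply: contraT => yx.
by have := coded_dist_ge R yx; rewrite coded_dist_sym leNgt xy.
Qed.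

Lemma coded_cvg (F : set_system X) (x : X) {FF : Filter F} :
  (forall i, \forall y \near F, b i y = b i x) -> F --> x.
Proof.
move=> Fx A /nbhs_ballP[e /= e0 xeA].
have [n ne] : exists n, 2^-1 ^+ n < e.
  have : (fun n => 2^-1 ^+ n) @ \oo --> (0 : R).
    by apply: cvg_expr; rewrite ger0_norm ?invr_ge0// invf_lt1// ltr1n.
  move=> /cvgrPdist_lt/(_ _ e0)[n _ /(_ n (leqnn n))] /=.
  by rewrite sub0r normrN ger0_norm ?exprn_ge0 ?invr_ge0//; exists n.
have : \forall y \near F, forall i, (i <= n)%N -> b i y = b i x.
  elim: n {ne} => [|n IH].
    by near=> y => i; rewrite leqn0 => /eqP ->; near: y; exact: Fx.
  near=> y => i; rewrite leq_eqVlt => /predU1P[->|].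
    by near: y; exact: Fx.
  by rewrite ltnS; move: i; near: y.
apply: filterS => y xy; apply: xeA; rewrite ballEmdist /=.
apply: lt_trans ne; apply: coded_dist_lt => i /xy //.
Unshelve. all: by end_near. Qed.

Lemma coded_continuous (f : X -> X) :
  (forall i x, \forall y \near x, b i (f y) = b i (f x)) -> continuous f.
Proof.
move=> fP x; have FF : Filter (f @ x).
  by apply: fmap_proper_filter; exact: nbhs_pfilter.
by apply: coded_cvg => i; exact: fP.
Qed.

(** An ultrafilter decides every test, so it converges as soon as some point
    passes exactly the tests that it decides positively. *)
Lemma coded_compact :
  (forall F : set_system X, UltraFilter F ->
     exists x : X, forall i, \forall y \near F, b i y = b i x) ->
  compact [set: X].
Proof.
move=> ult; rewrite compact_ultra => F FU _.
by have [x Fx] := ult F FU; exists x; split=> //; exact: coded_cvg.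
Qed.

End coded_topology.

(** * Sums along binary digits *)

Section digit_sum.
Variables (H : zmodType) (lab : nat -> H).

Definition digit_sum (n : nat) : H :=
  \sum_(0 <= r < n | odd (n %/ 2 ^ r)) lab r.

Lemma digit_sum0 : digit_sum 0 = 0.
Proof. by rewrite /digit_sum big_geq. Qed.

Let digit_sum_widen m n : (n < 2 ^ m)%N ->
  digit_sum n = \sum_(0 <= r < m | odd (n %/ 2 ^ r)) lab r.
Proof.
have widen p q : (n < 2 ^ p)%N -> (p <= q)%N ->
    \sum_(0 <= r < q | odd (n %/ 2 ^ r)) lab r =
    \sum_(0 <= r < p | odd (n %/ 2 ^ r)) lab r.
  move=> np pq; rewrite (big_cat_nat (n := p))//= [X in _ + X]big_nat_cond.
  rewrite [X in _ + X]big1 ?addr0// => r /andP[/andP[pr _]].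
  by rewrite divn_small// (leq_trans np)// leq_exp2l.
move=> nm; rewrite /digit_sum -(widen m (maxn m n)) ?leq_maxl//.
by rewrite -(widen n (maxn m n)) ?leq_maxr// ltn_expl.
Qed.

(** The digits of a multiple of [2 ^ N] and those of a number below [2 ^ N]
    occupy disjoint places, so they add up without carry. *)
Lemma digit_sumD N j e : (e < 2 ^ N)%N ->
  digit_sum (2 ^ N * j + e) = digit_sum (2 ^ N * j) + digit_sum e.
Proof.
move=> eN; have le_exp (m p : nat) : (m <= p)%N -> (m < 2 ^ p)%N.
  by move=> mp; rewrite (leq_ltn_trans mp)// ltn_expl.
have [p [Np pje pj]] : exists p, [/\ (N <= p)%N, (2 ^ N * j + e < 2 ^ p)%N &
    (2 ^ N * j < 2 ^ p)%N].
  exists (N + (2 ^ N * j + e))%N; split; rewrite ?leq_addr//.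
    by apply: le_exp; rewrite leq_addl.
  by apply: le_exp; rewrite addnCA leq_addr.
rewrite (digit_sum_widen pje) (digit_sum_widen pj).
rewrite (digit_sum_widen eN).
have cut (P : pred nat) : \sum_(0 <= r < p | P r) lab r =
    \sum_(0 <= r < N | P r) lab r + \sum_(N <= r < p | P r) lab r.
  by rewrite (big_cat_nat (n := N)).
rewrite [LHS]cut [X in _ = X + _]cut.
rewrite [X in _ = X + _ + _]big_nat_cond.
rewrite [X in _ = X + _ + _]big1 ?add0r; last first.
  move=> r /andP[/andP[_ rN]].
  rewrite -(subnKC rN) addSnnS expnD -mulnA mulKn ?expn_gt0//.
  by rewrite expnS -mulnA mul2n odd_double.
rewrite addrC; congr (_ + _).
  rewrite [LHS]big_nat_cond [RHS]big_nat_cond; apply: eq_bigl => r.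
  case: (leqP N r) => //= Nr; congr (_ && odd _).
  rewrite -(subnKC Nr) expnD !divnMA (mulnC (2 ^ N)%N j).
  by rewrite divnMDl ?expn_gt0// (divn_small eN) addn0 mulnK ?expn_gt0.
rewrite [LHS]big_nat_cond [RHS]big_nat_cond; apply: eq_bigl => r.
case: (ltnP r N) => //= rN.
rewrite -(subnKC rN) addSnnS expnD -mulnA (mulnC (2 ^ r)%N) divnMDl ?expn_gt0//.
by rewrite oddD expnS -mulnA mul2n odd_double.
Qed.

Lemma digit_sum_exp r : digit_sum (2 ^ r) = lab r.
Proof.
rewrite (@digit_sum_widen r.+1) ?ltn_exp2l// big_mkcond big_nat_recr//=.
rewrite divnn expn_gt0 /= big_nat_cond big1 ?add0r// => i /andP[/andP[_ ir] _].
by rewrite -(subnKC ir) addSnnS expnD mulKn ?expn_gt0// expnS mul2n odd_double.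
Qed.

Lemma digit_sum_top N j :
  digit_sum (2 ^ N.+1 * j + 2 ^ N) = digit_sum (2 ^ N.+1 * j) + lab N.
Proof. by rewrite digit_sumD ?ltn_exp2l// digit_sum_exp. Qed.

(** Subtracting [d] from a nonzero multiple of a large power of two borrows from
    all the middle places: the digits [r1] and [r2] become 1. *)
Lemma digit_sum_borrow r1 r2 j d : (r1 < r2)%N -> (0 < d <= 2 ^ r1)%N ->
  exists j' e, digit_sum (2 ^ r2.+1 * j.+1 - d) =
    digit_sum j' + lab r2 + (lab r1 + digit_sum e).
Proof.
move=> r12 /andP[d0 dr].
have e1 : (2 ^ r1 - d < 2 ^ r1)%N by rewrite ltn_subrL d0 expn_gt0.
have E1 : (2 ^ r1.+1 = 2 * 2 ^ r1)%N by rewrite expnS.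
have E2 : (2 ^ r2.+1 = 2 * 2 ^ r2)%N by rewrite expnS.
pose k := (2 ^ (r2 - r1.+1))%N.
have kE : (2 ^ r2 = 2 ^ r1.+1 * k)%N by rewrite -expnD subnKC.
have k0 : (0 < k)%N by rewrite expn_gt0.
pose e := (2 ^ r1.+1 * k.-1 + 2 ^ r1 + (2 ^ r1 - d))%N.
have er : (e < 2 ^ r2)%N.
  rewrite kE -[in X in (_ < X)%N](prednK k0) mulnS /e.
  by rewrite -addnA addnC ltn_add2r; lia.
exists (2 ^ r2.+1 * j)%N, (2 ^ r1.+1 * k.-1 + (2 ^ r1 - d))%N.
have -> : (2 ^ r2.+1 * j.+1 - d = 2 ^ r2.+1 * j + (2 ^ r2 * 1 + e))%N.
  have -> : e = (2 ^ r2 - d)%N by rewrite /e kE -{2}(prednK k0) mulnS; lia.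
  have : (d <= 2 ^ r2)%N by rewrite (leq_trans dr)// leq_exp2l// ltnW.
  by rewrite mulnS muln1; lia.
rewrite digit_sumD; last by rewrite muln1; lia.
rewrite digit_sumD// muln1 digit_sum_exp addrA; congr (_ + _).
have -> : e = (2 ^ r1.+1 * k.-1 + (2 ^ r1 * 1 + (2 ^ r1 - d)))%N.
  by rewrite /e muln1 addnA.
rewrite digit_sumD ?muln1; last by rewrite E1; lia.
rewrite -[X in digit_sum (X + _)]muln1 digit_sumD// muln1 digit_sum_exp.
by rewrite [in RHS]digit_sumD 1?addrCA//; lia.
Qed.

End digit_sum.

(** * Monoids of labels and the points they define *)

Lemma wf_minimal (T : Type) (r : T -> T -> Prop) (P : T -> Prop) :
  well_founded r -> (exists x, P x) ->
  exists2 x, P x & forall y, r y x -> ~ P y.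
Proof.
move=> rwf [x Px]; apply: contrapT => nmin.
elim/(well_founded_ind rwf): x Px => x IH Px.
by apply: nmin; exists x => // y /IH.
Qed.

(** The 2-adic valuation takes every value infinitely often; composing it with
    an enumeration gives one with infinite repetition. *)
Lemma enumerate_often (T : Type) (A : set T) : countable A -> A !=set0 ->
  exists e : nat -> T, (forall n, A (e n)) /\
    forall x, A x -> forall n, exists2 m, (n <= m)%N & e m = x.
Proof.
move=> /countable_injP[f finj] [x0 Ax0].
pose g n := if pselect (exists2 x, A x & f x = n) is left h
  then projT1 (cid2 h) else x0.
have Ag n : A (g n) by rewrite /g; case: pselect => // h; case: cid2.
have gf x : A x -> g (f x) = x.
  move=> Ax; rewrite /g; case: pselect => [h|[]]; last by exists x.
  by case: cid2 => y Ay /= /finj; apply; rewrite inE.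
exists (g \o logn 2); split=> [n|x Ax n]; first exact: Ag.
exists (n.*2.+1 * 2 ^ f x)%N.
  by rewrite -[leqLHS]muln1 leq_mul ?expn_gt0// -addnn; lia.
by rewrite /= logn_Gauss ?pfactorK ?gf// coprime2n /= odd_double.
Qed.

Definition strict_divisor (H : zmodType) (L : pred H) (h g : H) :=
  [/\ L h, L g, L (g - h) & g != h].

(** A commutative monoid with zero, presented as the quotient of the submonoid
    [ambient] of a group by the ideal of its elements that are not [live].
    Living in a group provides cancellation, on which both the separate
    continuity of the product and the absence of asymptotic pairs rest. *)
Record label_monoid := LabelMonoid {
  label_group :> zmodType;
  label_countable : countable [set: label_group];
  ambient : pred label_group;
  live : pred label_group;
  ambientD : forall g h, ambient g -> ambient h -> ambient (g + h);
  liveW : forall g, live g -> ambient g;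
  live0 : live 0;
  live_hered : forall g h, ambient g -> ambient h -> live (g + h) -> live g;
  divisor_wf : well_founded (strict_divisor live);
  live_extend : forall g, live g ->
    exists u, [/\ live u, u != 0 & live (g + u)];
  nil2 : label_group;
  live_nil2 : live nil2;
  nil2_neq0 : nil2 != 0;
  nil2_square : ~~ live (nil2 + nil2) }.

Section label_points.
Variable H : label_monoid.
Local Notation G := (@ambient H).
Local Notation L := (@live H).
Local Notation q := (nil2 H).

Let labelling : exists e : nat -> H, (forall n, L (e n) /\ e n != 0) /\
  forall u, L u /\ u != 0 -> forall n, exists2 m, (n <= m)%N & e m = u.
Proof.
apply: (@enumerate_often _ [set u : H | L u /\ u != 0]).
  exact: sub_countable (subset_card_le (@subsetT _ _)) (label_countable H).
by exists q; rewrite /= live_nil2 nil2_neq0.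
Qed.

Definition lab : nat -> H := projT1 (cid labelling).

Lemma live_lab r : L (lab r).
Proof. by rewrite /lab; case: cid => e /= [/(_ r)[]]. Qed.

Lemma lab_neq0 r : lab r != 0.
Proof. by rewrite /lab; case: cid => e /= [/(_ r)[]]. Qed.

Lemma lab_often u n : L u -> u != 0 -> exists2 r, (n <= r)%N & lab r = u.
Proof. by rewrite /lab; case: cid => e /= [_ elab] Lu u0; exact: elab. Qed.

Local Notation ds := (digit_sum lab).

Lemma ambient0 : G 0. Proof. exact/liveW/live0. Qed.

Lemma live_heredr g h : G g -> G h -> L (g + h) -> L h.
Proof. by move=> Gg Gh; rewrite addrC; exact: live_hered. Qed.

Lemma ambient_digit_sum n : G (ds n).
Proof.
rewrite /digit_sum; elim/big_ind : _ => [|g h|r _].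
- exact: ambient0.
- exact: ambientD.
- exact/liveW/live_lab.
Qed.

(** If the sum vanished, its top label and the rest would be opposite live
    elements; then 0 and the rest would be strict divisors of each other. *)
Lemma digit_sum_neq0 n : (0 < n)%N -> ds n != 0.
Proof.
move=> n0; pose r := trunc_log 2 n.
have /andP[rn nr] := trunc_log_bounds (ltnSn 1) n0.
have nE : n = (2 ^ r * 1 + (n - 2 ^ r))%N by rewrite muln1 subnKC.
have dsE : ds n = lab r + ds (n - 2 ^ r).
  rewrite {1}nE digit_sumD ?muln1 ?digit_sum_exp//.
  by rewrite ltn_subLR// addnn -mul2n -expnS.
apply/eqP; rewrite dsE => s0; set g := ds (n - 2 ^ r) in s0.
have gE : g = - lab r by apply/eqP; rewrite -subr_eq0 opprK addrC s0.
have Lg : L g.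
  apply: (live_heredr (liveW (live_lab r)) (ambient_digit_sum _)).
  by rewrite s0 live0.
have g0 : g != 0 by rewrite gE oppr_eq0 lab_neq0.
have sg : strict_divisor L g 0.
  split; rewrite ?live0// 1?eq_sym//.
  by rewrite sub0r gE opprK live_lab.
have s0g : strict_divisor L 0 g by split; rewrite ?live0 ?subr0.
suff : forall x, x = 0 \/ x = g -> False by apply; left.
elim/(well_founded_ind (@divisor_wf H)) => x IH [xE|xE]; subst x.
  by apply: (IH g) => //; right.
by apply: (IH 0) => //; left.
Qed.

(** Just before a multiple of a large power of two, two digits labelled [nil2]
    occur, so the sum is dead.  This makes negative times invisible: the
    sequence to the left of a far recurrence time looks like zero. *)
Lemma digit_sum_before d : (0 < d)%N -> exists N, forall n g, G g ->
  (2 ^ N %| n)%N -> (0 < n)%N -> ~~ L (g + ds (n - d)).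
Proof.
move=> d0.
have [r1 dr1 lr1] := lab_often d (live_nil2 H) (nil2_neq0 H).
have [r2 r12 lr2] := lab_often r1.+1 (live_nil2 H) (nil2_neq0 H).
exists r2.+1 => n g Gg /dvdnP[[|j]]; first by rewrite mul0n => ->.
rewrite mulnC => -> _.
have [|j' [e E]] := @digit_sum_borrow _ lab r1 r2 j d r12.
  by rewrite d0 (leq_trans dr1)// ltnW// ltn_expl.
apply: contra (nil2_square H); rewrite E lr1 lr2.
have -> : g + (digit_sum lab j' + q + (q + digit_sum lab e)) =
    (q + q) + (g + digit_sum lab j' + digit_sum lab e).
  by rewrite [LHS](AC (1*(2*2)) ((3*4)*((1*2)*5))).
have Gq := liveW (live_nil2 H).
by apply: live_hered; do !apply: ambientD => //; exact: ambient_digit_sum.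
Qed.

(** [Some (a, g)] stands for the sequence [t |-> g + digit_sum lab (t + a)],
    which is zero where this sum is dead or [t + a] is negative, and [None] for
    the zero sequence. *)
Definition label_point : Type := option (int * {h : H | L h}).
HB.instance Definition _ := Choice.on label_point.

Definition label_pt (a : int) (h : H) : label_point := omap (pair a) (insub h).

Definition translate (n : int) (y : label_point) : label_point :=
  omap (fun p => (p.1 + n, p.2)) y.

Definition label_mul (y z : label_point) : label_point :=
  match y, z with
  | Some (a, g), Some (b, h) => label_pt (a + b) (val g + val h)
  | _, _ => None
  end.

(** The test [(t, k)] asks whether the sequence takes the live value [k] at time
    [t].  The topology given by these tests is that of pointwise convergence in
    the one-point compactification of the discrete set of live elements. *)
Definition label_test (p : int * H) (y : label_point) : bool :=
  if y is Some (a, g) then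
    [&& L p.2, 0 <= p.1 + a & val g + ds `|p.1 + a| == p.2]
  else false.

Variant point_spec : label_point -> Type :=
  | PointNone : point_spec None
  | PointPt a h of L h : point_spec (label_pt a h).

Lemma label_pointP y : point_spec y.
Proof.
case: y => [[a [h Lh]]|]; last by constructor.
by have := @PointPt a h Lh; rewrite /label_pt insubT.
Qed.

Lemma label_ptN a h : ~~ L h -> label_pt a h = None.
Proof. by move=> /negbTE Lh; rewrite /label_pt insubF. Qed.

Lemma label_pt_inj a b g h :
  L g -> label_pt a g = label_pt b h -> a = b /\ g = h.
Proof.
move=> Lg; rewrite /label_pt insubT; case: insubP => //= u _ <- [-> e].
by rewrite -e.
Qed.

Lemma translate_pt n a h : translate n (label_pt a h) = label_pt (a + n) h.
Proof. by rewrite /label_pt; case: insubP. Qed.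

Lemma label_mul_pt a b g h : G g -> G h ->
  label_mul (label_pt a g) (label_pt b h) = label_pt (a + b) (g + h).
Proof.
move=> Gg Gh; have [Lg|nLg] := boolP (L g); last first.
  rewrite (label_ptN _ nLg) (label_ptN (_ + _))//.
  by apply: contra nLg; exact: live_hered.
have [Lh|nLh] := boolP (L h); last first.
  rewrite (label_ptN _ nLh) (label_ptN (_ + _)); last first.
    by apply: contra nLh; exact: live_heredr.
  by rewrite /label_mul; case: label_pt => // -[].
by rewrite [in LHS]/label_pt !insubT.
Qed.

Lemma label_mulC y z : label_mul y z = label_mul z y.
Proof.
by case: y z => [[a g]|] [[b h]|] //=; rewrite (addrC b) (addrC (val h)).
Qed.

Lemma label_mulN y : label_mul y None = None. Proof. by case: y => // -[]. Qed.

Lemma test_pt t k a h : G h ->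
  label_test (t, k) (label_pt a h) =
  [&& L k, 0 <= t + a & h + ds `|t + a| == k].
Proof.
move=> Gh; have [Lh|nLh] := boolP (L h); first by rewrite /label_pt insubT.
rewrite label_ptN//=; apply/esym/and3P => -[Lk _ /eqP hk].
move: Lk; rewrite -hk.
by move=> /(live_hered Gh (ambient_digit_sum _)); apply/negP.
Qed.

Lemma test_translate t k n y :
  label_test (t, k) (translate n y) = label_test (t + n, k) y.
Proof. by case: y => [[a h]|]//=; rewrite (addrC a) addrA. Qed.

(** By cancellation a test of a product by a fixed point is again a test, or
    constantly false; this is the separate continuity of the product. *)
Lemma test_mul t k a g z : L g ->
  label_test (t, k) (label_mul (label_pt a g) z) =
  L k && label_test (t + a, k - g) z.
Proof.
move=> Lg; case: (label_pointP z) => [|b h Lh].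
  by rewrite label_mulN andbF.
have [Gg Gh] := (liveW Lg, liveW Lh).
rewrite label_mul_pt// !test_pt//; last exact: ambientD.
rewrite addrA; case: (boolP (L k)) => //= Lk.
case: (0 <= _) => /=; last by rewrite andbF.
rewrite -(addrA g) (eq_sym _ (k - g)) subr_eq eq_sym (addrC g).
case: eqP => [kE|]; last by rewrite andbF.
rewrite andbT; apply/esym; move: Lk; rewrite kE addrK.
by apply: live_hered => //; apply: ambientD => //; exact: ambient_digit_sum.
Qed.

(** A point [(a, g)] takes its value [g] at the first time [-a] at which it is
    not zero, so the sequence determines [a], and then [g]. *)
Lemma test_separates y z :
  (forall p, label_test p y = label_test p z) -> y = z.
Proof.
have start a g w : L g ->
    label_test (- a, g) w = label_test (- a, g) (label_pt a g) ->
    label_test (- a, g) w.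
  by move=> Lg ->; rewrite test_pt ?liveW// Lg addNr lexx digit_sum0 addr0 eqxx.
case: (label_pointP y) => [|a g Lg]; case: (label_pointP z) => [|b h Lh]// yz.
- by have := start b h None Lh (yz _).
- by have := start a g None Lg (esym (yz _)).
have := start a g _ Lg (esym (yz _)).
have := start b h _ Lh (yz _).
rewrite !test_pt ?liveW// => /and3P[_ ba _] /and3P[_ ab /eqP hg].
have e : a = b by lia.
by subst b; rewrite -hg addNr digit_sum0 addr0.
Qed.

Lemma translateD m n y : translate m (translate n y) = translate (n + m) y.
Proof. by case: y => [[a h]|]//=; rewrite addrA. Qed.

Lemma translate0 y : translate 0 y = y.
Proof. by case: y => [[a h]|]//=; rewrite addr0. Qed.

Lemma translate_mul n y z :
  translate n (label_mul y z) = label_mul y (translate n z).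
Proof.
case: (label_pointP y) => [|a g Lg]//; case: (label_pointP z) => [|b h Lh].
  by rewrite label_mulN.
by rewrite translate_pt !label_mul_pt ?liveW// translate_pt addrA.
Qed.

Lemma mul_orbit n y : label_mul y (label_pt n 0) = translate n y.
Proof.
case: (label_pointP y) => [|a g Lg]//.
by rewrite label_mul_pt ?addr0 ?translate_pt ?ambient0 ?liveW.
Qed.

(** At a time [t >= 0] the digit [r] adds its label [u] without carry once
    [2 ^ r] exceeds [t]; at negative times both sides are zero. *)
Lemma test_translate_exp u p y : L u ->
  exists N, forall r, (N <= r)%N -> lab r = u ->
    label_test p (translate (2 ^ r)%N%:Z y) =
    label_test p (label_mul (label_pt 0 u) y).
Proof.
case: p => t k Lu; case: (label_pointP y) => [|a h Lh].
  by exists 0%N; rewrite label_mulN.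
have [Gu Gh] := (liveW Lu, liveW Lh).
case e : (t + a) => [d|d].
  exists d => r dr ru; rewrite test_translate label_mul_pt// !test_pt//;
    last exact: ambientD.
  have d2r : (d < 2 ^ r)%N by rewrite (leq_ltn_trans dr)// ltn_expl.
  have := digit_sumD lab 1 d2r; rewrite muln1 digit_sum_exp ru => dsE.
  by rewrite add0r addrAC e -PoszD /= addnC dsE addrA (addrC u).
have [N bef] := digit_sum_before (ltn0Sn d).
exists N => r Nr ru; rewrite test_translate label_mul_pt// !test_pt//;
  last exact: ambientD.
rewrite add0r e /= andbF addrAC e; apply/and3P => -[Lk r0 /eqP kE].
have := bef (2 ^ r)%N h Gh (dvdn_exp2l _ Nr).
rewrite expn_gt0 => /(_ isT)/negP; apply.
have <- : absz (Negz d + (2 ^ r)%N%:Z) = (2 ^ r - d.+1)%N.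
  by move: r0; rewrite NegzE; move: (2 ^ r)%N => m; lia.
by rewrite kE.
Qed.

End label_points.

(** * The system of a monoid of labels *)

Section label_dynamics.
Variables (R : realType) (H : label_monoid).
Local Notation G := (@ambient H).
Local Notation L := (@live H).
Local Notation q := (nil2 H).
Local Notation ds := (digit_sum (lab H)).

Lemma test_index_subproof :
  exists e : nat -> int * H, forall p, exists n, e n = p.
Proof.
have := @enumerate_often (int * H)%type [set: int * H].
case => [||e [_ /= esurj]].
- rewrite -setXTT.
  by apply: countableX; [exact: countableP|exact: label_countable].
- by exists (0, 0).
by exists e => p; have [m _ mp] := esurj p Logic.I 0%N; exists m.
Qed.

Definition test_index := projT1 (cid test_index_subproof).

Lemma test_indexP p : exists n, test_index n = p.
Proof. by rewrite /test_index; case: cid => e /=. Qed.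

Definition coded_test (n : nat) (y : label_point H) :=
  label_test (test_index n) y.

Lemma coded_test_separates : separates coded_test.
Proof.
move=> y z yz; apply: test_separates => p.
by have [n <-] := test_indexP p; exact: yz.
Qed.

Definition label_space : metricType R := coded R coded_test_separates.

Lemma test_near p (y : label_space) :
  \forall z \near y, label_test p z = label_test p y.
Proof. by have [n <-] := test_indexP p; exact: coded_near. Qed.

Lemma test_cvg (F : set_system label_space) (y : label_space) {FF : Filter F} :
  (forall p, \forall z \near F, label_test p z = label_test p y) -> F --> y.
Proof. by move=> Fy; apply: coded_cvg => n; exact: Fy. Qed.

Lemma test_continuous (f : label_space -> label_space) :
  (forall p y, \forall z \near y, label_test p (f z) = label_test p (f y)) ->
  continuous f.
Proof. by move=> fP; apply: coded_continuous => n y; exact: fP. Qed.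

Lemma translate_continuous n :
  continuous (translate n : label_space -> label_space).
Proof.
apply: test_continuous => -[t k] y; have := test_near (t + n, k) y.
by apply: filterS => z; rewrite !test_translate.
Qed.

Lemma label_mul_continuous (y : label_space) :
  continuous (label_mul y : label_space -> label_space).
Proof.
apply: test_continuous => -[t k] z; case: (label_pointP y) => [|a g Lg].
  by near=> u.
have := test_near (t + a, k - g) z.
by apply: filterS => u; rewrite !test_mul// => ->.
Unshelve. all: by end_near. Qed.

(** If an ultrafilter makes no test true it tends to [None].  Otherwise take a
    value [h] that it takes at some time [t0] and that is minimal for strict
    divisibility.  A digit 1 of the time at which [h] is read could be removed,
    which would give a strict divisor of [h] as a value at an earlier time; so
    every digit eventually vanishes, and the limit is [(- t0, h)]. *)
Lemma label_space_compact : compact [set: label_space].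
Proof.
apply: coded_compact => F FU.
suff [x Fx] : exists x : label_space,
    forall p, \forall y \near F, label_test p y = label_test p x.
  by exists x => n; exact: Fx.
have [[[t1 h1] Fh1]|noF] := pselect (exists p, F [set y | label_test p y]);
  last first.
  exists None => p; have [Fp|] := in_ultra_setVsetC [set y | label_test p y] FU.
    by case: noF; exists p.
  by apply: filterS => y /negP/negbTE.
have [h [t0 Fh] hmin] := wf_minimal (@divisor_wf H)
  (ex_intro (fun h => exists t, F [set y | label_test (t, h) y]) h1
    (ex_intro _ t1 Fh1)).
have Lh : L h.
  have [y] := filter_ex Fh.
  case: (label_pointP y) => [//|a g Lg].
  by rewrite /= test_pt ?liveW// => /and3P[].
pose near_multiple N := [set y : label_space | exists a g j,
  [/\ L g, y = label_pt a g, t0 + a = (2 ^ N * j)%N%:Z &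
      g + ds (2 ^ N * j)%N = h]].
have Fmult N : F (near_multiple N).
  elim: N => [|N IH].
    apply: filterS Fh => y /=; case: (label_pointP y) => [//|a g Lg].
    rewrite test_pt ?liveW// => /and3P[_ ta /eqP gh].
    by exists a, g, (absz (t0 + a)); rewrite expn0 mul1n gez0_abs.
  pose odd_multiple := [set y : label_space | exists a g j,
    [/\ L g, y = label_pt a g, t0 + a = (2 ^ N.+1 * j + 2 ^ N)%N%:Z &
    g + ds (2 ^ N.+1 * j + 2 ^ N)%N = h]].
  have [Fodd|Feven] := in_ultra_setVsetC odd_multiple FU.
    (* Removing the digit [N] contradicts the minimality of [h]. *)
    have : F [set y | label_test (t0 - (2 ^ N)%N%:Z, h - lab H N) y].
      apply: filterS Fodd => y [a [g [j [Lg -> ta gh]]]] /=.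
      rewrite test_pt ?liveW//.
      have -> : t0 - (2 ^ N)%N%:Z + a = (2 ^ N.+1 * j)%N%:Z.
        by rewrite addrAC ta PoszD addrK.
      have E : h - lab H N = g + ds (2 ^ N.+1 * j)%N.
        by rewrite -gh digit_sum_top addrA addrK.
      rewrite E eqxx andbT /= andbT.
      apply: (@live_hered H _ (lab H N)).
      - by apply: ambientD; [exact: liveW|exact: ambient_digit_sum].
      - exact/liveW/live_lab.
      - by rewrite -addrA -digit_sum_top gh.
    move=> Fpred; have [_ [a [g [j [Lg _ _ gh]]]]] := filter_ex Fodd.
    case: (hmin (h - lab H N)); last by exists (t0 - (2 ^ N)%N%:Z).
    have Lhl : L (h - lab H N).
      have [y] := filter_ex Fpred.
      case: (label_pointP y) => [//|b k Lk].
      by rewrite /= test_pt ?liveW// => /and3P[].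
    split=> //; first by rewrite opprB addrC subrK live_lab.
    by rewrite -subr_eq0 opprB addrC subrK lab_neq0.
  apply: filterS2 IH Feven => y [a [g [j [Lg yE ta gh]]]] nodd.
  exists a, g, j./2; have jE := odd_double_half j.
  case: (boolP (odd j)) jE => oj /= jE; last first.
    have jE' : (2 ^ N.+1 * j./2 = 2 ^ N * j)%N.
      by rewrite -[in RHS]jE add0n expnS -mul2n mulnCA mulnA.
    by rewrite jE'.
  case: nodd; exists a, g, j./2.
  have jE' : (2 ^ N.+1 * j./2 + 2 ^ N = 2 ^ N * j)%N.
    by rewrite -[in RHS]jE mulnDr muln1 expnS -mul2n addnC mulnCA mulnA.
  by rewrite jE'.
exists (label_pt (- t0) h) => -[t k]; rewrite test_pt ?liveW//.
case e : (t - t0) => [d|d].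
  apply: filterS (Fmult d) => y [a [g [j [Lg -> ta gh]]]].
  rewrite test_pt ?liveW//.
  have -> : t + a = (2 ^ d * j + d)%N%:Z.
    by rewrite PoszD -e -ta [RHS]addrC addrA subrK.
  by rewrite /= (digit_sumD (lab H) j (ltn_expl d (ltnSn 1))) addrA gh.
(* Before the time [t0] the limit is zero, and so are the nearby points, because
   of the two digits labelled [nil2]. *)
have [N bef] := digit_sum_before H (ltn0Sn d).
apply: filterS (Fmult N) => y [a [g [j [Lg -> ta gh]]]].
rewrite test_pt ?liveW// /= andbF; apply/and3P => -[Lk ta0 /eqP gk].
have taE : t + a = (2 ^ N * j)%N%:Z - d.+1%:Z.
  by rewrite -NegzE -e -ta [RHS]addrC addrA subrK.
have := bef (2 ^ N * j)%N g (liveW Lg) (dvdn_mulr _ (dvdnn _)).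
have j0 : (0 < 2 ^ N * j)%N.
  by move: ta0; rewrite taE; move: (2 ^ N * j)%N => m; lia.
move=> /(_ j0)/negP; apply.
have <- : absz (t + a) = (2 ^ N * j - d.+1)%N.
  by move: ta0; rewrite taE; move: (2 ^ N * j)%N => m; lia.
by rewrite gk.
Qed.

Lemma label_space_nonempty : [set: label_space] !=set0.
Proof. by exists None. Qed.

Lemma translateK n :
  cancel (translate n : label_space -> label_space) (translate (- n)).
Proof. by move=> y; rewrite translateD subrr translate0. Qed.

Lemma translateNK n :
  cancel (translate (- n) : label_space -> label_space) (translate n).
Proof. by move=> y; rewrite translateD addNr translate0. Qed.

Definition label_sys : system R :=
  @System R label_space label_space_nonempty label_space_compact
    (translate 1) (translate (- 1)) (translateK 1) (translateNK 1)
    (@translate_continuous 1) (@translate_continuous (- 1)).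

Lemma smap_powE n (y : label_sys) : smap_pow n y = translate n y.
Proof.
case: n => n /=.
  elim: n => [|n IH]; first by rewrite translate0.
  by rewrite iterS IH /= translateD -addn1 PoszD.
elim: n => [|n IH] //.
rewrite iterS IH /= translateD; congr (translate _ _); lia.
Qed.

Lemma countable_label_sys : countable_system label_sys.
Proof.
have [f finj] : exists f : H -> nat, injective f.
  have /countable_injP[f finj] := label_countable H.
  by exists f => x y; apply: finj; rewrite inE.
apply/countable_injP.
exists (fun y : label_sys =>
  pickle (omap (fun p => (p.1, f (val p.2))) (y : label_point H))).
move=> y z _ _ /(pcan_inj (@pickleK _)).
case: y z => [[a g]|] [[b h]|] //= [-> /finj gh].
by congr (Some (_, _)); exact: val_inj.
Qed.

End label_dynamics.

(** * Dynamics of the system of a monoid of labels *)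

Section label_dynamics.
Variables (R : realType) (H : label_monoid).
Local Notation G := (@ambient H).
Local Notation L := (@live H).
Local Notation q := (nil2 H).
Local Notation ds := (digit_sum (lab H)).
Local Notation X := (label_sys R H).

(** Large digits [r] that carry the label [u]. *)
Definition lab_times (u : H) : set_system nat :=
  filter_from [set: nat] (fun n => [set r | (n <= r)%N /\ lab H r = u]).

Lemma lab_times_proper u : L u -> u != 0 -> ProperFilter (lab_times u).
Proof.
move=> Lu u0; apply: filter_from_proper; last first.
  by move=> n _; have [r] := lab_often n Lu u0; exists r.
apply: filter_from_filter; first by exists 0%N.
move=> m n _ _; exists (maxn m n) => // r /= [].
by rewrite geq_max => /andP[-> ->] ->.
Qed.

Lemma lab_timesW u n : \forall r \near lab_times u, (n <= r)%N.
Proof. by exists n => // r []. Qed.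

Lemma translate_exp_cvg u (y : X) : L u ->
  (fun r => translate (2 ^ r)%N%:Z y : X) @ lab_times u -->
    (label_mul (label_pt 0 u) y : X).
Proof.
move=> Lu; have ? : Filter (lab_times u).
  apply: filter_from_filter; first by exists 0%N.
  move=> m n _ _; exists (maxn m n) => // r /= [].
  by rewrite geq_max => /andP[-> ->] ->.
apply: test_cvg => p.
have [N NP] := test_translate_exp p y Lu.
by exists N => // r [Nr ru]; exact: NP.
Qed.

(** Two steps [2 ^ r1] and [2 ^ r2] with both digits labelled [nil2] amount in
    the limit to a product with the square of [nil2], which is [None]. *)
Lemma nil2_translates (A : set X) (y z : X) n : nbhs (None : X) A ->
  exists m, [/\ (n <= m)%N, A (translate m%:Z y) & A (translate m%:Z z)].
Proof.
move=> /nbhs_interior nA.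
have [Lq q0] := (live_nil2 H, nil2_neq0 H).
have FF := lab_times_proper Lq q0.
have qqN (x : X) : label_mul (label_pt 0 q) (label_mul (label_pt 0 q) x) = None.
  case: (label_pointP x) => [|a g Lg]; first by rewrite !label_mulN.
  rewrite !label_mul_pt ?ambientD ?liveW// label_ptN// addrA.
  apply: contra (nil2_square H); apply: live_hered; last exact: liveW.
  by apply: ambientD; exact: liveW.
have near_q (x : X) : \forall r \near lab_times q,
    (A^° : set X) (translate (2 ^ r)%N%:Z (label_mul (label_pt 0 q) x)).
  have : \forall u \near (None : X), (A^° : set X) u by exact: nA.
  by rewrite -(qqN x); exact: translate_exp_cvg.
have [r1 [Ay [Az nr1]]] := filter_ex
  (filterI (near_q y) (filterI (near_q z) (lab_timesW q n))).
have near_q2 (x : X) :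
    (A^° : set X) (translate (2 ^ r1)%N%:Z (label_mul (label_pt 0 q) x)) ->
    \forall r \near lab_times q,
      A (translate (2 ^ r)%N%:Z (translate (2 ^ r1)%N%:Z x)).
  rewrite translate_mul => qA.
  exact: (translate_exp_cvg (y := translate (2 ^ r1)%N%:Z x) Lq qA).
have [r2 [Ay2 Az2]] := filter_ex (filterI (near_q2 _ Ay) (near_q2 _ Az)).
exists (2 ^ r1 + 2 ^ r2)%N.
rewrite !translateD -PoszD in Ay2 Az2; split=> //.
rewrite (leq_trans nr1)// (leq_trans (ltnW (ltn_expl r1 (ltnSn 1))))//.
by rewrite leq_addr.
Qed.

Lemma orbit_dense (y : X) (A : set X) : nbhs y A ->
  exists n, A (translate n (label_pt 0 0)).
Proof.
case: (label_pointP y) => [|a g Lg] yA.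
  have [m [_ Am _]] := nil2_translates (label_pt 0 0) (label_pt 0 0) 0%N yA.
  by exists m%:Z.
have [g0|g0] := eqVneq g 0; first subst g.
  by exists a; rewrite translate_pt add0r; exact: (nbhs_singleton yA).
have FF := lab_times_proper Lg g0.
have /filter_ex[r Ar] : \forall r \near lab_times g,
    A (translate (2 ^ r)%N%:Z (label_pt a 0)).
  apply: (translate_exp_cvg (y := label_pt a 0) Lg).
  by rewrite label_mul_pt ?ambient0 ?liveW// add0r addr0.
exists (a + (2 ^ r)%N%:Z); move: Ar.
by rewrite !translate_pt add0r.
Qed.

Lemma label_sys_transitive : topologically_transitive X.
Proof.
move=> U V oU oV [u Uu] [v Vv].
have [n Un] := orbit_dense (open_nbhs_nbhs (conj oU Uu)).
have [m Vm] := orbit_dense (open_nbhs_nbhs (conj oV Vv)).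
exists (n - m), (translate m (label_pt 0 0)); split=> //=.
by rewrite smap_powE translateD addrC subrK.
Qed.

(** A pointwise limit [f] of powers of the translation is the product with
    [f x], where [x] is the neutral point [(0, 0)]: powers of the translation are
    products with points of the orbit of [x], and the product is continuous in
    each variable. *)
Lemma label_sys_WAP : WAP X.
Proof.
move=> f clf; pose x0 : X := label_pt 0 0.
have fE : forall y, f y = label_mul y (f x0).
  move=> y; apply: test_separates => p.
  pose A1 := [set g : {ptws X -> X} | label_test p (g y) = label_test p (f y)].
  pose A2 := [set g : {ptws X -> X} |
    label_test p (label_mul y (g x0)) = label_test p (label_mul y (f x0))].
  have nA1 : nbhs f A1.
    exact: (@proj_continuous _ (fun _ : X => X) y f _ (test_near p (f y : X))).
  have nA2 : nbhs f A2.
    have := @label_mul_continuous R H y (f x0) _ (test_near p _).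
    exact: (@proj_continuous _ (fun _ : X => X) x0 f).
  have [_ [[n _ <-] []]] := clf _ (filterI nA1 nA2).
  by rewrite /A1 /A2 /= !smap_powE translate_pt add0r mul_orbit => <- <-.
have -> : (f : X -> X) = label_mul (f x0).
  by apply/funext => y; rewrite fE label_mulC.
exact: label_mul_continuous.
Qed.

Lemma label_sys_proximal (y z : X) : proximal y z.
Proof.
rewrite /proximal limn_einf_lim; apply/cvg_lim => //.
have -> : einfs (fun n => (orbit_dist y z n)%:E) = cst 0%E.
  apply/funext => n; apply/eqP; rewrite eq_le; apply/andP; split; last first.
    by apply: le_ereal_inf_tmp => _ [m _ <-]; rewrite lee_fin mdist_ge0.
  apply/lee_addgt0Pr => e e0; rewrite add0e.
  have e20 : 0 < e / 2 by rewrite divr_gt0.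
  have [m [nm]] := nil2_translates y z n (nbhsx_ballx (None : X) _ e20).
  rewrite !ballEmdist /= => ym zm.
  apply: (@le_trans _ _ (orbit_dist y z m)%:E).
    by apply: ereal_inf_lbound; exists m.
  rewrite lee_fin (splitr e) /orbit_dist.
  rewrite (le_trans (metric_triangle _ (None : X) _))//.
  by rewrite !smap_powE lerD// ltW// metric_sym.
exact: cvg_cst.
Qed.

(** Some [u <> 0] keeps [u + g] alive, and by cancellation the products of two
    distinct points with [(0, u)] are then distinct.  They are the limits of the
    two orbits along the times [2 ^ r] with [r] labelled [u]. *)
Lemma label_sys_not_asymptotic (y z : X) : y <> z -> ~ asymptotic y z.
Proof.
have main : forall (a : int) (g : H) (z : X), L g -> (label_pt a g : X) <> z ->
    exists u, [/\ L u, u != 0 &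
      label_mul (label_pt 0 u) (label_pt a g) <> label_mul (label_pt 0 u) z].
  move=> a g {}z Lg yz; have [u [Lu u0 Lgu]] := live_extend Lg.
  exists u; split=> //; move: yz; case: (label_pointP z) => [|b h Lh] yz.
    by rewrite label_mulN label_mul_pt ?liveW// /label_pt insubT// addrC.
  rewrite !label_mul_pt ?liveW// !add0r addrC => /(label_pt_inj Lgu)[ab gh].
  apply: yz; rewrite ab; congr (label_pt _ _).
  by apply: (addIr u); rewrite gh addrC.
move=> yz.
have [u [Lu u0 uyz]] : exists u, [/\ L u, u != 0 &
    label_mul (label_pt 0 u) y <> label_mul (label_pt 0 u) z].
  move: yz; case: (label_pointP y) => [|a g Lg]; last exact: main.
  case: (label_pointP z) => [//|a g Lg] /nesym/(main _ _ _ Lg)[u [Lu u0 uyz]].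
  by exists u; split=> //; exact: nesym.
have [n nyz] : exists n, @coded_test H n (label_mul (label_pt 0 u) y)
    != @coded_test H n (label_mul (label_pt 0 u) z).
  apply: contrapT => alleq; apply: uyz; apply: (@coded_test_separates H) => n.
  by apply/eqP; apply: contraT => nyz; case: alleq; exists n.
have FF := lab_times_proper Lu u0.
move=> /cvgrPdist_lt/(_ (2^-1 ^+ n)) [|N _ NP].
  by rewrite exprn_gt0// invr_gt0.
have near_test (x : X) : \forall r \near lab_times u,
    coded_test n (translate (2 ^ r)%N%:Z x) =
    coded_test n (label_mul (label_pt 0 u) x).
  exact: (translate_exp_cvg (y := x) Lu
    (@coded_near R _ _ (@coded_test_separates H) n
      (label_mul (label_pt 0 u) x))).
have [r [yr [zr Nr]]] := filter_ex
  (filterI (near_test y) (filterI (near_test z) (lab_timesW u N))).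
have := NP (2 ^ r)%N; rewrite /= => /(_ _)/wrap[].
  by rewrite (leq_trans Nr)// ltnW// ltn_expl.
rewrite sub0r normrN ger0_norm ?mdist_ge0// /orbit_dist !smap_powE.
apply/negP; rewrite -leNgt; apply: coded_dist_ge.
by rewrite /= in yr zr; rewrite yr zr.
Qed.

Lemma RT_label_mul u (y : X) : L u -> u != 0 ->
  RT y (label_mul (label_pt 0 u) y).
Proof.
move=> Lu u0; left => A B [N _ NA] uB.
have nB : \forall r \near lab_times u, B (translate (2 ^ r)%N%:Z y).
  exact: (translate_exp_cvg (y := y) Lu uB).
have FF := lab_times_proper Lu u0.
have [r [Br Nr]] := filter_ex (filterI nB (lab_timesW u N)).
exists (translate (2 ^ r)%N%:Z y); split=> //.
rewrite -smap_powE; apply: NA => /=.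
by rewrite (leq_trans Nr)// ltnW// ltn_expl.
Qed.

Lemma zLIM_label_mul u (Y : set X) (y : X) : L u -> u != 0 -> Y y ->
  zLIM Y (label_mul (label_pt 0 u) y).
Proof.
by move=> Lu u0 Yy; apply: subset_closure; exists y => //; exact: RT_label_mul.
Qed.

Lemma RT_None : RT (None : X) None.
Proof.
left => A B [N _ NA] /nbhs_singleton B0; exists None; split=> //.
have : A (smap_pow N%:Z (None : X)) by exact: (NA N (leqnn N)).
by rewrite smap_powE.
Qed.

Lemma RT_test p (y z : X) N : RT y z -> label_test p z ->
  exists n : int, (N <= absz n)%N /\ label_test p (translate n y).
Proof.
have step (s : nat -> int) : (forall n, absz (s n) = n) ->
    cluster ((fun n : nat => smap_pow (s n) y) @ \oo) z -> label_test p z ->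
    exists n : int, (N <= absz n)%N /\ label_test p (translate n y).
  move=> sE zs pz.
  have := zs [set w | exists n : int, (N <= absz n)%N /\ w = translate n y] _ _
    (test_near p (z : X)).
  case; first by exists N => // n /= Nn; exists (s n); rewrite sE smap_powE.
  by move=> w [[n [Nn ->]] /=]; rewrite pz; exists n.
by case=> /step; apply=> n //; rewrite abszN.
Qed.

(** If the value [g] of [(a, g)] at its first time [- a] is approached by
    far translates of some [(b, h)] in [Y], then [g] is [h] plus a nonempty sum
    of labels. *)
Lemma zLIM_divisor (Y : set X) a g : L g -> zLIM Y (label_pt a g) ->
  exists b h, Y (label_pt b h) /\ strict_divisor L h g.
Proof.
move=> Lg /(_ _ (test_near (- a, g) (label_pt a g : X))).
have -> : label_test (- a, g) (label_pt a g).
  by rewrite test_pt ?liveW// Lg addNr lexx digit_sum0 addr0 eqxx.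
move=> [z [[y Yy yz] zg]].
(* The translate has to be far enough for its first time not to be [- a]. *)
have [n [+ +]] :=
  RT_test (if y is Some (b, _) then (absz (b - a)).+1 else 0)%N yz zg.
case: (label_pointP y) Yy {yz} => [//|b h Lh] Yy.
rewrite {1}/label_pt insubT /= => nb.
rewrite translate_pt test_pt ?liveW// => /and3P[_ _ /eqP hg].
exists b, h; split=> //.
pose m := absz (- a + (b + n)); have m0 : (0 < m)%N by rewrite /m; lia.
have gh : g - h = ds m by rewrite -hg addrAC subrr add0r.
split=> //; last by rewrite -subr_eq0 gh; exact: digit_sum_neq0.
rewrite gh; apply: (live_heredr (liveW Lh) (ambient_digit_sum _ _)).
by rewrite hg.
Qed.

End label_dynamics.

(** * Ordinals and the sequence of iterated limit sets *)

Lemma wo_le_lt_trans (W : wotype) (x y z : W) :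
  wo_le x y -> wo_lt y z -> wo_lt x z.
Proof. by move=> xy; apply: contra => zx; exact: wo_trans xy. Qed.

Lemma wo_lt_le_trans (W : wotype) (x y z : W) :
  wo_lt x y -> wo_le y z -> wo_lt x z.
Proof. by move=> xy yz; apply: contra xy; exact: wo_trans. Qed.

Lemma wo_lt_trans (W : wotype) (x y z : W) :
  wo_lt x y -> wo_lt y z -> wo_lt x z.
Proof. by move=> /wo_ltW; exact: wo_le_lt_trans. Qed.

Lemma wo_least (W : wotype) (P : W -> Prop) : (exists x, P x) ->
  exists2 x, P x & forall y, P y -> wo_le x y.
Proof.
move=> [x Px].
have [|z [[/asboolP Pz zmin] _]] :=
    wo_leP (w := W) (A := [pred y | `[< P y >]]).
  by exists x; apply/asboolP.
by exists z => // y Py; apply: zmin; apply/asboolP.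
Qed.

Lemma wo_succ_exists (W : wotype) (v w : W) : wo_lt v w ->
  exists2 s, is_succ_of v s & wo_le s w.
Proof.
move=> vw; have [s vs smin] := wo_least (ex_intro (fun s => wo_lt v s) w vw).
by exists s; [split|exact: smin].
Qed.

Section wo_sum.
Variables V W : wotype.

Definition wo_sum_le : rel (V + W) := fun x y =>
  match x, y with
  | inl a, inl b => wo_le a b
  | inl _, inr _ => true
  | inr _, inl _ => false
  | inr a, inr b => wo_le a b
  end.

Lemma wo_sum_leP : well_order wo_sum_le.
Proof.
apply: antisymmetric_well_order => [[x|x] [y|y]//= /andP[xy yx]|A [a Aa]].
- by rewrite (wo_anti xy yx).
- by rewrite (wo_anti xy yx).
have [[v Av]|noV] := pselect (exists v, inl v \in A).
  have [z Az zmin] := wo_least (ex_intro (fun v => inl v \in A) v Av).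
  by exists (inl z); split=> // -[u|//] /zmin.
case: a Aa => [v Av|w Aw]; first by case: noV; exists v.
have [z Az zmin] := wo_least (ex_intro (fun w => inr w \in A) w Aw).
by exists (inr z); split=> // -[u Au|u /zmin//]; case: noV; exists u.
Qed.

Definition wo_sum : wotype := WOType wo_sum_leP.

End wo_sum.

Section wo_segment.
Variables (W : wotype) (w : W).

Definition segment_le : rel {v : W | ~~ wo_le w v} :=
  fun x y => wo_le (sval x) (sval y).

Lemma segment_leP : well_order segment_le.
Proof.
apply: antisymmetric_well_order =>
  [[x xw] [y yw] /= /andP[xy yx]|A [[a aw] Aa]].
  by apply: eq_exist => /=; exact: wo_anti.
have [z [zw Az] zmin] := wo_least
  (ex_intro (fun v => exists vw, exist _ v vw \in A) a (ex_intro _ aw Aa)).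
by exists (exist _ z zw); split=> // -[u uw] Au; apply: zmin; exists uw.
Qed.

Definition wo_segment : wotype := WOType segment_leP.

End wo_segment.

Section zpos_theory.
Variables (R : realType) (S : system R).
Local Notation zS := (@zpos R S _).

Lemma subset_zLIM (Y Y' : set S) : Y `<=` Y' -> zLIM Y `<=` zLIM Y'.
Proof. by move=> YY'; apply: closure_subset; exact: bigcup_subset. Qed.

(** Monotonicity of [zLIM] suffices: it gives the successor step, and at a limit
    it compares with each of the earlier terms. *)
Lemma zLIM_zpos (W : wotype) (w : W) : zLIM (zS w) `<=` zS w.
Proof.
elim/(well_founded_ind (@wo_lt_wf W)): w => w IH.
have [[v vw]|nw] := pselect (exists v, is_succ_of v w).
  by rewrite (zpos_succ S vw); apply: subset_zLIM; apply: IH; case: vw.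
rewrite (zpos_limit S (w := w)) => [|v vw]; last by apply: nw; exists v.
move=> x zx v vw; apply: (IH v vw); apply: subset_zLIM zx.
exact: bigcap_inf.
Qed.

Lemma zpos_nonincreasing (W : wotype) (v w : W) : wo_le v w ->
  zS w `<=` zS v.
Proof.
elim/(well_founded_ind (@wo_lt_wf W)): w => w IH vw.
have [/wo_anti wv|/negP wv] := pselect (wo_le w v); first by rewrite wv.
have [[u uw]|nw] := pselect (exists u, is_succ_of u w); last first.
  rewrite (zpos_limit S (w := w)) => [|u uw]; last by apply: nw; exists u.
  exact: bigcap_inf.
have uw' : wo_lt u w by case: uw.
rewrite (zpos_succ S uw); apply: subset_trans (@zLIM_zpos W u) _.
apply: IH => //; apply: contrapT => /negP uv; have [_ /(_ _ uv) wv'] := uw.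
by rewrite wv' in wv.
Qed.

Lemma z_initial (V B : wotype) (w : B) (f : V -> B) :
  (forall x y, wo_le (f x) (f y) = wo_le x y) ->
  range f = [set u | wo_lt u w] -> z_ S V = zS w.
Proof.
move=> fmono frange; pose g (x : wo_succ V) := if x is Some v then f v else w.
have fw v : wo_lt (f v) w.
  have : range f (f v) by exists v.
  by rewrite frange.
rewrite /z_ -(@zpos_initial _ S (wo_succ V) B g) //.
- move=> [x|] [y|] //=; last exact: wo_refl.
    exact: wo_ltW.
  exact/negbTE/fw.
- move=> v u uv; have uw : wo_lt u w.
    by case: v uv => [v|//] uv; exact: wo_lt_trans uv (fw v).
  have : range f u by rewrite frange.
  by move=> [v' _ <-]; exists (Some v').
Qed.

(** Index the sets by [alpha + 1] followed by a well-ordered uncountable type.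
    While they are not contained in [[set e]] each one has a point that the next
    one has lost; such points are distinct, so countability stops the process at
    a least index [w0], and the segment below [w0] is the height.  As the sets
    decrease, [w0] comes after all of [alpha]. *)
Lemma height_gt_rest_point (e : S) (alpha : wotype) :
  countable_system S -> RT e e ->
  (forall Y : set S, Y `<=` zLIM Y -> Y `<=` [set e]) ->
  ~ z_ S alpha `<=` [set e] -> height_gt S alpha.
Proof.
move=> Sct ee stable nalpha.
have [hle hleP] := well_ordering_principle {eclassic (set nat)}.
pose B := wo_sum (wo_succ alpha) (WOType hleP).
have [w0 w0e w0min] : exists2 w : B, zS w `<=` [set e] &
    forall v : B, zS v `<=` [set e] -> wo_le w v.
  apply: wo_least; apply: contrapT => none.
  have exit (w : B) : exists x, zS w x /\ ~ zLIM (zS w) x.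
    apply: contrapT => nx; apply: none; exists w; apply: stable => x wx.
    by apply: contrapT => nz; apply: nx; exists x.
  have [phi phiP] := choice exit.
  have phi_lt v w : wo_lt v w -> phi v <> phi w.
    move=> vw vwE; have [s vs sw] := wo_succ_exists vw.
    have := zpos_nonincreasing sw (phiP w).1.
    by rewrite (zpos_succ S vs) -vwE; exact: (phiP v).2.
  have phi_inj : injective phi.
    move=> v w vwE; apply: wo_anti; apply: contrapT => /negP.
      by move/phi_lt; apply.
    by move/phi_lt; apply.
  have [c cinj] : exists c : S -> nat, injective c.
    have /countable_injP[c cinj] := Sct.
    by exists c => x y; apply: cinj; rewrite inE.
  pose h (A : {eclassic (set nat)}) := c (phi (inr A : B)).
  have hinj : injective h by move=> A A' /cinj/phi_inj[].
  pose D : set nat := [set n | exists2 A : set nat, h A = n & ~ A n].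
  have [D1|D1] := pselect (D (h D)).
    by have [A /hinj -> /(_ D1)] := D1.
  by case: (D1); exists D.
pose omega : B := inl None.
have omegaE : z_ S alpha = zS omega.
  apply: (@z_initial _ _ _ (fun a : alpha => inl (Some a) : B)) => //.
  apply/seteqP; split=> [_ [a _ <-]//|[[a|]|b] //= _].
  by exists a.
have omega_w0 : wo_lt omega w0.
  apply/negP => /zpos_nonincreasing w0omega; apply: nalpha.
  by rewrite omegaE; exact: subset_trans w0e.
pose W := wo_segment w0.
have WE : z_ S W = zS w0.
  apply: (@z_initial W B w0 (fun v : W => sval v)) => //.
  by apply/seteqP; split=> [_ [[v vw] _ <-]//|v vw]; exists (exist _ v vw).
exists W; split; first split.
- rewrite z_succ WE; apply/seteqP; split; last exact: zLIM_zpos.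
  move=> x w0x; have xe := w0e _ w0x; rewrite xe in w0x *.
  by apply: subset_closure; exists e.
- move=> V [w [f [fmono frange]]] VE.
  have VwE : z_ S V = zS (sval w : B).
    apply: (@z_initial V B _ (fun v => sval (f v))) => [x y|].
      exact: fmono.
    apply/seteqP; split=> [_ [v _ <-]|u uw].
      by have : range f (f v) by [exists v]; rewrite frange.
    have uw0 : wo_lt u w0 := wo_lt_trans uw (svalP w).
    have : [set u : W | wo_lt u w] (exist _ u uw0) by [].
    by rewrite -frange => -[v _ vE]; exists v => //; rewrite vE.
  have := svalP w; apply/negP; rewrite negbK; apply: w0min.
  by apply: stable; rewrite -VwE -z_succ -VE.
- exists (exist _ omega omega_w0 : W).
  have aw0 (a : alpha) : wo_lt (inl (Some a) : B) w0.
    exact: (@wo_lt_trans B _ omega).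
  exists (fun a => exist _ (inl (Some a) : B) (aw0 a) : W); split=> //.
  apply/seteqP; split=> [_ [a _ <-]//|[[[a|]|b] uw] //= _].
  by exists a => //; exact: eq_exist.
Qed.

End zpos_theory.

(** * The monoid of a descending labelling *)

Section descent.
Variables (W : wotype) (rho : nat -> W).

Definition nonneg_poly (f : {poly int}) : Prop := forall i, 0 <= f`_i.

(** The indices of the negative coefficients form a strictly decreasing sequence
    of ordinals under [rho], so sets of such indices admit no infinite strictly
    increasing chain; this is what bounds chains of divisors. *)
Definition descending (f : {poly int}) : Prop :=
  (forall i, -1 <= f`_i) /\
  forall i j, (i < j)%N -> f`_i < 0 -> f`_j < 0 -> wo_lt (rho j) (rho i).

(** The first component is the grading; two elements of degree one have a dead
    sum. *)
Definition descent_ambient : pred (int * {poly int}) := fun g =>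
  [&& 0 <= g.1, (g.1 == 0) ==> `[< nonneg_poly g.2 >] &
      (g.1 == 1) ==> `[< descending g.2 >]].

Definition descent_live : pred (int * {poly int}) := fun g =>
  descent_ambient g && (g.1 <= 1).

Lemma nonneg_polyD f g : nonneg_poly f -> nonneg_poly g -> nonneg_poly (f + g).
Proof. by move=> f0 g0 i; rewrite coefD addr_ge0. Qed.

Lemma descendingD f g : descending f -> nonneg_poly g -> descending (f + g).
Proof.
move=> [f1 fdec] g0; have lefg i : f`_i <= (f + g)`_i by rewrite coefD lerDl.
split=> [i|i j ij fi fj]; first exact: le_trans (lefg i).
by apply: fdec => //; [exact: le_lt_trans fi|exact: le_lt_trans fj].
Qed.

Lemma descent_ambientP (j : int) f : reflect
  [/\ 0 <= j, j = 0 -> nonneg_poly f & j = 1 -> descending f]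
  (descent_ambient (j, f)).
Proof.
apply: (iffP and3P) => /= -[j0 j1 j2]; split=> //.
- by move=> jE; move: j1; rewrite jE eqxx => /asboolP.
- by move=> jE; move: j2; rewrite jE eqxx => /asboolP.
- by apply/implyP => /eqP/j1/asboolP.
- by apply/implyP => /eqP/j2/asboolP.
Qed.

Lemma descent_ambientD g h :
  descent_ambient g -> descent_ambient h -> descent_ambient (g + h).
Proof.
case: g h => [i f] [j g].
move=> /descent_ambientP[i0 fi0 fi1] /descent_ambientP[j0 gj0 gj1].
apply/descent_ambientP; split => /= [|ij|ij]; first exact: addr_ge0.
  by apply: nonneg_polyD; [apply: fi0|apply: gj0]; lia.
have [[iE jE]|[iE jE]] : i = 1 /\ j = 0 \/ i = 0 /\ j = 1 by lia.
  by apply: descendingD; [exact: fi1|exact: gj0].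
by rewrite addrC; apply: descendingD; [exact: gj1|exact: fi0].
Qed.

Lemma descent_hered g h : descent_ambient g -> descent_ambient h ->
  descent_live (g + h) -> descent_live g.
Proof.
move=> Gg Gh /andP[_]; rewrite /descent_live Gg.
case: g h Gg Gh => [i f] [j g] /descent_ambientP[i0 _ _].
by move=> /descent_ambientP[j0 _ _] /=; lia.
Qed.

Definition coef_sum (f : {poly int}) : int := f.[1].

Lemma nonneg_coef_sum f : nonneg_poly f -> 0 <= coef_sum f.
Proof.
move=> f0; rewrite /coef_sum horner_coef sumr_ge0// => i _.
by rewrite expr1n mulr1.
Qed.

Lemma nonneg_coef_sum_gt0 f : nonneg_poly f -> f != 0 -> 0 < coef_sum f.
Proof.
move=> f0 fn0; rewrite lt_neqAle nonneg_coef_sum// andbT eq_sym.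
apply: contra fn0; rewrite /coef_sum horner_coef.
rewrite psumr_eq0 => [/allP all0|i _]; last by rewrite expr1n mulr1.
apply/eqP/polyP => i; rewrite coef0.
have [fi|fi] := ltnP i (size f); last by rewrite nth_default.
have := all0 (Ordinal fi) (mem_index_enum _).
by rewrite /= expr1n mulr1 => /eqP.
Qed.

Let divides := strict_divisor descent_live.

Lemma divides_step (j : int) f (i : int) g : divides (i, g) (j, f) ->
  0 <= i <= j /\ (j = i -> nonneg_poly (f - g) /\ coef_sum g < coef_sum f).
Proof.
move=> [/andP[/descent_ambientP[i0 _ _] _] _].
move=> /andP[/descent_ambientP[ji fg0 _] _] fg.
have {}ji : 0 <= j - i := ji.
have {}fg0 : j - i = 0 -> nonneg_poly (f - g) := fg0.
split=> [|jiE]; first by lia.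
have fg1 : nonneg_poly (f - g) by apply: fg0; rewrite jiE subrr.
split=> //; rewrite -subr_gt0 /coef_sum -hornerN -hornerD.
rewrite nonneg_coef_sum_gt0// subr_eq0.
by apply: contra fg => /eqP ->; rewrite jiE.
Qed.

Lemma Acc_nonneg f : descent_live (0, f) -> Acc divides (0, f).
Proof.
have live_nonneg g : descent_live (0, g) -> nonneg_poly g.
  by move=> /andP[/descent_ambientP[_ /(_ erefl)]].
have main n : forall f, nonneg_poly f -> coef_sum f < n%:Z ->
    Acc divides (0, f).
  elim: n => [|n IH] {}f f0 fn; first by have := nonneg_coef_sum f0; lia.
  constructor => -[i g] ig; have [i0 step] := divides_step ig.
  have iE : i = 0 by lia.
  subst i; have [_ gf] := step erefl.
  by apply: IH; [apply: live_nonneg; case: ig|lia].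
move=> /live_nonneg f0; apply: (main (absz (coef_sum f)).+1) => //.
by have := nonneg_coef_sum f0; lia.
Qed.

Lemma descending_coef_sum f N : descending f ->
  (forall i, (N <= i)%N -> 0 <= f`_i) -> 0 <= coef_sum f + N%:Z.
Proof.
move=> [f1 _] fN; have -> : N%:Z = (\poly_(i < N) (1 : int)).[1].
  rewrite horner_poly (eq_bigr (fun=> 1)) => [|i _]; last first.
    by rewrite expr1n mulr1.
  by rewrite sumr_const card_ord natz.
rewrite /coef_sum -hornerD; apply: nonneg_coef_sum => i.
rewrite coefD coef_poly.
case: ltnP => iN; last by rewrite addr0 fN.
by have := f1 i; lia.
Qed.

(** Lexicographic descent on an ordinal and a natural number.  While no negative
    coefficient appears at an index at least [N], a step to a divisor lowers the
    sum of the coefficients, which is at least [- N].  When one appears, at [j],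
    every later one lies after [j] and has a smaller ordinal than [rho j], and
    [N] is raised to the size of the polynomial. *)
Lemma Acc_descending f : descending f -> Acc divides (1, f).
Proof.
have main (b : wo_succ W) : forall (n N : nat) f, descending f ->
    (forall i, (N <= i)%N -> 0 <= f`_i) ->
    (forall g, descending g -> nonneg_poly (f - g) ->
      forall i, (N <= i)%N -> g`_i < 0 -> wo_lt (Some (rho i) : wo_succ W) b) ->
    coef_sum f + N%:Z < n%:Z -> Acc divides (1, f).
  elim/(well_founded_ind (@wo_lt_wf (wo_succ W))): b => b IHb n.
  elim: n => [|n IHn] N {}f fd fN fb fn.
    by have := descending_coef_sum fd fN; lia.
  constructor => -[i g] ig; have [/andP[i0 i1] step] := divides_step ig.
  have [i0E|i1E] : i = 0 \/ i = 1 by lia.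
    by subst i; apply: Acc_nonneg; case: ig.
  subst i; have [fg gf] := step erefl.
  have gd : descending g.
    by case: ig => /andP[/descent_ambientP[_ _ /(_ erefl)]].
  have [gN|] := pselect (forall i, (N <= i)%N -> 0 <= g`_i).
    apply: (IHn N) => //; last by lia.
    move=> h hd hg; apply: fb => //.
    by rewrite -(subrK g f) -addrA; exact: nonneg_polyD.
  move=> /existsNP[j /not_implyP[Nj /negP]]; rewrite -ltNge => gj.
  have jb := fb g gd fg j Nj gj.
  have jg : (j < size g)%N.
    by rewrite ltnNge; apply/negP => sj; move: gj; rewrite nth_default.
  have gs i : (size g <= i)%N -> 0 <= g`_i by move=> si; rewrite nth_default.
  apply: (IHb _ jb (absz (coef_sum g + (size g)%:Z)).+1 (size g)) => //.
    move=> h [h1 hdec] gh i si hi; apply: (hdec j i) => //.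
      exact: leq_trans jg si.
    by have := gh j; rewrite coefB subr_ge0 => /le_lt_trans; apply.
  by have := descending_coef_sum gd gs; lia.
move=> fd; have fs i : (size f <= i)%N -> 0 <= f`_i.
  by move=> si; rewrite nth_default.
apply: (main None (absz (coef_sum f + (size f)%:Z)).+1 (size f)) => //.
by have := descending_coef_sum fd fs; lia.
Qed.

Lemma divides_wf : well_founded divides.
Proof.
move=> [j f]; have [/andP[fa j1]|nl] := boolP (descent_live (j, f)); last first.
  by constructor => h [_ hl]; rewrite hl in nl.
have [j0 _ fd] := descent_ambientP _ _ fa.
have [jE|jE] : j = 0 \/ j = 1 by rewrite /= in j1; lia.
  by subst j; apply: Acc_nonneg; rewrite /descent_live fa.
by rewrite jE; apply: Acc_descending; exact: fd.
Qed.

Lemma nonneg_poly0 : nonneg_poly 0. Proof. by move=> i; rewrite coef0. Qed.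

Lemma descending0 : descending 0.
Proof. by split=> [i|i j _]; rewrite coef0. Qed.

Lemma nonneg_polyXn i : nonneg_poly 'X^i.
Proof. by move=> k; rewrite coefXn; case: eqP. Qed.

Lemma descent_live_nonneg f : nonneg_poly f -> descent_live (0, f).
Proof. by move=> f0; rewrite /descent_live andbT; apply/descent_ambientP. Qed.

Lemma descent_live_descending f : descending f -> descent_live (1, f).
Proof. by move=> fd; rewrite /descent_live andbT; apply/descent_ambientP. Qed.

Lemma descent_liveW g : descent_live g -> descent_ambient g.
Proof. by case/andP. Qed.

Lemma Xn_neq0 i : (0, 'X^i) != 0 :> (int * {poly int})%type.
Proof. by rewrite xpair_eqE /= -size_poly_eq0 size_polyXn. Qed.

Lemma descent_extend g : descent_live g ->
  exists u, [/\ descent_live u, u != 0 & descent_live (g + u)].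
Proof.
move=> /andP[ga g1]; have X0 := descent_live_nonneg (nonneg_polyXn 0).
exists (0, 'X^0); split; [exact: X0|exact: Xn_neq0|].
by rewrite /descent_live descent_ambientD//= ?addr0// descent_liveW.
Qed.

Lemma descent_nil2 : ~~ descent_live ((1, 0) + (1, 0)).
Proof. by rewrite /descent_live andbF. Qed.

(** Adding ['X^0] extends every live element, and [(1, 0)], of degree one, has
    a dead double. *)
Definition descent_monoid : label_monoid := {|
  label_countable := countableP [set: int * {poly int}];
  ambientD := descent_ambientD;
  liveW := descent_liveW;
  live0 := descent_live_nonneg nonneg_poly0;
  live_hered := descent_hered;
  divisor_wf := divides_wf;
  live_extend := descent_extend;
  live_nil2 := descent_live_descending descending0;
  nil2_neq0 := isT : (1, 0) != 0 :> (int * {poly int})%type;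
  nil2_square := descent_nil2 |}.

Hypothesis rho_often : forall w n, exists2 m, (n <= m)%N & rho m = w.

(** At a successor [v + 1], write [f] as [f - 'X^i] plus ['X^i] with [i] beyond
    the degree of [f] and [rho i = v]; the first term gives a point of the set
    of index [v] by induction. *)
Lemma descending_zpos (R : realType) (w : W) (f : {poly int}) a :
  descending f -> (forall i, f`_i < 0 -> wo_le w (rho i)) ->
  @zpos R (label_sys R descent_monoid) W w (@label_pt descent_monoid a (1, f)).
Proof.
elim/(well_founded_ind (@wo_lt_wf W)): w f a => w IH f a fd fw.
have [[v vw]|nw] := pselect (exists v, is_succ_of v w); last first.
  rewrite zpos_limit => [v vw|v vw]; last by apply: nw; exists v.
  by apply: IH => // i /fw; apply: wo_trans; exact: wo_ltW.
have [vw' _] := vw; rewrite (zpos_succ _ vw).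
have [i fi iv] := rho_often v (size f).
have gd : descending (f - 'X^i).
  have [f1 fdec] := fd; split=> [k|k l kl].
    rewrite coefB coefXn; case: eqP => [->|_]; last by rewrite subr0.
    by rewrite nth_default.
  rewrite !coefB !coefXn; case: (eqVneq k i) => [ki|ki].
    rewrite (gtn_eqF _) -?ki// (nth_default _ (_ : size f <= l)%N) ?subrr//.
    by rewrite (leq_trans fi)// -ki ltnW.
  rewrite subr0; case: (eqVneq l i) => [->|li]; last first.
    by rewrite subr0; exact: fdec.
  by move=> /fw wk _; rewrite iv; exact: wo_lt_le_trans vw' wk.
have Xl := descent_live_nonneg (nonneg_polyXn i).
have -> : @label_pt descent_monoid a (1, f) =
    label_mul (@label_pt descent_monoid 0 (0, 'X^i))
      (@label_pt descent_monoid a (1, f - 'X^i)).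
  rewrite label_mul_pt; last 2 first.
  - exact: descent_liveW.
  - exact/descent_liveW/descent_live_descending.
  rewrite add0r; congr label_pt.
  by rewrite -[RHS]/(0 + 1, 'X^i + (f - 'X^i)) add0r addrC subrK.
apply: zLIM_label_mul => //; first exact: Xn_neq0.
apply: IH => // k; rewrite coefB coefXn; case: eqP => [->|_].
  by rewrite iv => _; exact: wo_refl.
by rewrite subr0 => /fw; apply: wo_trans; exact: wo_ltW.
Qed.

End descent.


(** * A system of large height *)

Lemma countable_option (T : Type) :
  countable [set: T] -> countable [set: option T].
Proof.
move=> /countable_injP[f finj]; apply/countable_injP.
exists (fun x => if x is Some t then (f t).+1 else 0%N).
by move=> [x|] [y|] _ _ //= [/finj ->] //; rewrite inE.
Qed.

Theorem corollary6p14 (R : realType) (alpha : wotype)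
    (alpha_countable : countable [set: alpha]) :
  exists S : system R,
    [/\ topologically_transitive S, completely_scrambled S,
        countable_system S, WAP S & height_gt S alpha].
Proof.
(* Indexing by [alpha + 1] rather than [alpha] covers the empty [alpha]. *)
have [rho [_ rhoP]] := @enumerate_often (wo_succ alpha) [set: option alpha]
  (countable_option alpha_countable) (ex_intro _ None Logic.I).
have rho_often w n : exists2 m, (n <= m)%N & rho m = w by exact: rhoP.
pose S := label_sys R (descent_monoid rho); exists S; split.
- exact: label_sys_transitive.
- by split; [exact: label_sys_proximal|exact: label_sys_not_asymptotic].
- exact: countable_label_sys.
- exact: label_sys_WAP.
apply: (@height_gt_rest_point R S None).
- exact: countable_label_sys.
- exact: RT_None.
- move=> Y YzY y Yy; case: (label_pointP y) Yy => // a g Lg Yg; exfalso.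
  have [g0 [Lg0 [a0 Yg0]] gmin] := wf_minimal (@divisor_wf (descent_monoid rho))
    (ex_intro (fun g => live g /\ exists a, Y (label_pt a g)) g
      (conj Lg (ex_intro _ a Yg))).
  have [b [h [Yh hg]]] := zLIM_divisor Lg0 (YzY _ Yg0).
  by apply: (gmin h hg); split; [case: hg|exists b].
- have L1 := descent_live_descending (descending0 rho).
  have zN : z_ S alpha (@label_pt (descent_monoid rho) 0 (1, 0)).
    apply: (@descending_zpos (wo_succ alpha) rho rho_often R None 0 0).
      exact: descending0.
    by move=> i; rewrite coef0.
  by move=> /(_ _ zN); rewrite /label_pt insubT.
Qed.
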